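(* For any unit vector $|\psi\rangle\in\mathbb{C}^d$ with $|\psi\rangle\langle\psi|\in\mathrm{dom}(R^{\mathbb{D}}_{\mathcal{S}_+})$, $$R^{\mathbb{D}}_{\mathcal{S}_+}(|\psi\rangle\langle\psi|)=\Gamma_{\mathcal{V}}(|\psi\rangle)^2-1.$$
   Context: Fix $d\ge 1$. $\mathcal{V}\subseteq\mathbb{C}^d$ is a nonempty compact set of unit vectors such that $|\psi\rangle\in\mathcal{V}$ implies $e^{i\theta}|\psi\rangle\in\mathcal{V}$ for all real $\theta$. $\mathbb{D}$ is the set of $d\times d$ density matrices. Put $\mathcal{S}_+=\{|v\rangle\langle v| : |v\rangle\in\mathcal{V}\}$ and let $\mathcal{S}_+^{**}=\mathbb{R}_+\mathrm{conv}(\mathcal{S}_+)$ be the convex cone it generates. The atomic gauge of $\mathcal{V}$ is $\Gamma_{\mathcal{V}}(|\psi\rangle)=\inf\{\lambda\in\mathbb{R}_+ : |\psi\rangle\in\lambda\,\mathrm{conv}(\mathcal{V})\}=\inf\{\sum_i c_i : |\psi\rangle=\sum_i c_i|v_i\rangle \text{ (finite sum)},\ |v_i\rangle\in\mathcal{V},\ c_i\in\mathbb{R}_+\}$, with $\inf\emptyset=\infty$. The generalised robustness of a density matrix $\rho$ is $$R^{\mathbb{D}}_{\mathcal{S}_+}(\rho)=\inf\{s\in\mathbb{R}_+ : \exists\,\omega\in\mathbb{D},\ \rho+s\omega\in\mathcal{S}_+^{**}\}\in[0,\infty],$$ and $\mathrm{dom}(R^{\mathbb{D}}_{\mathcal{S}_+})$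 is the set where it is finite. *)

(* Defs.v *)
From HB Require Import structures.
From mathcomp Require Import all_boot all_order all_algebra complex.
From mathcomp Require Import all_classical all_reals all_analysis.

Set Implicit Arguments.
Unset Strict Implicit.
Unset Printing Implicit Defensive.

Import Order.TTheory GRing.Theory Num.Theory.
Import numFieldNormedType.Exports.

Local Open Scope classical_set_scope.
Local Open Scope ring_scope.
Local Open Scope sesquilinear_scope.
Local Open Scope complex_scope.

(* The usual topology of C, as the library defines it on [R[i]^o]; matrices over
   [R[i]] then carry the product topology. *)
HB.instance Definition _ (R : realType) := NormedModule.copy R[i] R[i]^o.

Section ConvexHull.
Context {R : realType} {E : lmodType R[i]}.

(* Complex spaces are regarded as real ones: all the coefficients below are
   real. *)
Definition conv (A : set E) : set E :=
  [set x | exists (n : nat) (c : 'I_n -> R) (a : 'I_n -> E),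
    [/\ forall i, 0 <= c i, \sum_i c i = 1, forall i, A (a i)
      & x = \sum_i (c i)%:C *: a i]].

Definition dilate (t : R) (A : set E) : set E := [set t%:C *: x | x in A].

Definition cone (A : set E) : set E :=
  [set x | exists2 t : R, 0 <= t & dilate t (conv A) x].

(* +oo when x is in no nonnegative multiple of conv A *)
Definition atomic_gauge (A : set E) (x : E) : \bar R :=
  ereal_inf [set t%:E | t in [set t : R | 0 <= t /\ dilate t (conv A) x]].

End ConvexHull.

Section Quantum.
Context {R : realType} {d : nat}.

(* Unit for the Hermitian inner product; the library's norm on matrices is the
   sup norm. *)
Definition unit_vector (v : 'cV[R[i]]_d) : Prop := (v ^t* *m v) 0 0 = 1.

Definition ketbra (v : 'cV[R[i]]_d) : 'M[R[i]]_d := v *m v ^t*.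

(* [0 <= z] in R[i] means that z is real and nonnegative. *)
Definition density_matrices : set 'M[R[i]]_d :=
  [set rho | [/\ rho \is hermsymmx,
                 forall v : 'cV[R[i]]_d, 0 <= (v ^t* *m rho *m v) 0 0
               & \tr rho = 1]].

Definition pure_states (V : set 'cV[R[i]]_d) : set 'M[R[i]]_d := ketbra @` V.

Definition robustness (S : set 'M[R[i]]_d) (rho : 'M[R[i]]_d) : \bar R :=
  ereal_inf [set s%:E | s in [set s : R | 0 <= s /\
    exists2 omega, density_matrices omega & cone S (rho + s%:C *: omega)]].

Definition robustness_dom (S : set 'M[R[i]]_d) : set 'M[R[i]]_d :=
  [set rho | density_matrices rho /\ robustness S rho \is a fin_num].

End Quantum.

(* exp (i theta) *)
Definition phase {R : realType} (theta : R) : R[i] := cos theta +i* sin theta.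

(* Main.v *)
(** If [psi = \sum_i c_i v_i] with [t = \sum_i c_i], then by Cauchy-Schwarz
    [t \sum_i c_i |v_i><v_i| - |psi><psi|] is positive semidefinite; its trace is
    [t ^ 2 - 1], so its normalisation is an admissible [omega]. Conversely, if
    [M = |psi><psi| + s omega = \sum_i p_i |v_i><v_i|], then [psi] is in the range
    of [M]: writing [psi = M x] gives [psi = \sum_i p_i <v_i|x> v_i], where the
    phases of the coefficients can be absorbed in the [v_i]. Since
    [|<x|psi>| ^ 2 <= <x|M|x> = <x|psi>], we have [<x|M|x> <= 1], and Cauchy-Schwarz
    gives [(\sum_i p_i |<v_i|x>|) ^ 2 <= (1 + s) <x|M|x> <= 1 + s]. *)

Require Import Defs.
From mathcomp Require Import all_boot all_order all_algebra complex.
From mathcomp Require Import all_classical all_reals all_analysis.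
From mathcomp Require Import ring lra.

Import Order.TTheory GRing.Theory Num.Theory.

Local Open Scope classical_set_scope.
Local Open Scope ring_scope.
Local Open Scope complex_scope.

(** * Scalar inequalities and convex combinations *)

(** Lagrange's identity: the nonnegative double sum of [p i * p j * (|x i| - |x j|) ^+ 2] is twice
    the defect of the inequality for the moduli. The general [F] lets it serve over both [R] and
    [R[i]]. *)
Lemma weighted_cauchy_schwarz (F : numDomainType) (I : finType) (p x : I -> F) :
  (forall i, 0 <= p i) ->
  `|\sum_i p i * x i| ^+ 2 <= (\sum_i p i) * \sum_i p i * `|x i| ^+ 2.
Proof.
move=> p_ge0; set P := \sum_i p i; set Q := \sum_i _ * `|_| ^+ 2.
pose S := \sum_i p i * `|x i|.
have S_ge0 : 0 <= S by apply: sumr_ge0 => i _; rewrite mulr_ge0.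
apply: (@le_trans _ _ (S ^+ 2)).
  rewrite lerXn2r ?nnegrE //; apply: le_trans (ler_norm_sum _ _ _) _.
  by apply: ler_sum => i _; rewrite normrM ger0_norm.
have : 0 <= \sum_i \sum_j p i * p j * (`|x i| - `|x j|) ^+ 2.
  do 2 (apply: sumr_ge0 => ? _); rewrite mulr_ge0 ?(mulr_ge0 (p_ge0 _)) //.
  by rewrite real_exprn_even_ge0 // rpredB.
suff -> : \sum_i \sum_j p i * p j * (`|x i| - `|x j|) ^+ 2 = (P * Q - S ^+ 2) *+ 2.
  by rewrite pmulrn_lge0 // subr_ge0.
transitivity (\sum_i (p i * `|x i| ^+ 2 * P + p i * Q - p i * `|x i| * S *+ 2)).
  apply: eq_bigr => i _; rewrite !mulr_sumr -sumrMnl -big_split /= -sumrB.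
  by apply: eq_bigr => j _; ring.
rewrite sumrB big_split /= sumrMnl -!mulr_suml -/P -/Q -/S; ring.
Qed.

Lemma complex_polar (R : realType) (z : R[i]) :
  exists theta : R, z = `|z| * phase theta.
Proof.
have [->|z_neq0] := eqVneq z 0; first by exists 0; rewrite normr0 mul0r.
case: z z_neq0 => a b z_neq0; rewrite normc_def /=.
set r := Num.sqrt _.
have r2 : r ^+ 2 = a ^+ 2 + b ^+ 2 by rewrite sqr_sqrtr // addr_ge0 ?sqr_ge0.
have r_gt0 : 0 < r.
  rewrite sqrtr_gt0 lt0r addr_ge0 ?sqr_ge0 // andbT paddr_eq0 ?sqr_ge0 //.
  rewrite !sqrf_eq0; apply: contra z_neq0 => /andP[/eqP-> /eqP->]; exact/eqP.
have rK x : r * (x / r) = x by rewrite mulrC divfK // gt_eqF.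
have ab1 : 1 - (a / r) ^+ 2 = (b / r) ^+ 2.
  rewrite !expr_div_n r2 -(mulfV (_ : a ^+ 2 + b ^+ 2 != 0)) -?r2; last first.
    by rewrite sqrf_eq0 gt_eqF.
  by rewrite r2 -mulrBl addrC addKr.
have a1 : -1 <= a / r <= 1.
  rewrite -ler_norml -(ler_pXn2r (_ : 0 < 2)%N) ?nnegrE ?ler01 //.
  by rewrite real_normK ?num_real // expr1n -subr_ge0 ab1 sqr_ge0.
suff [theta [ct st]] : exists theta : R, cos theta = a / r /\ sin theta = b / r.
  by exists theta; rewrite /phase ct st; simpc; rewrite !rK.
(* [acos] takes values where the sine is nonnegative, so the sign of [b] decides the sign of the
   angle. *)
have [b_ge0|b_lt0] := leP 0 (b / r).
  by exists (acos (a / r)); rewrite acosK ?sin_acos ?ab1 ?sqrtr_sqr ?ger0_norm.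
exists (- acos (a / r)).
by rewrite cosN sinN acosK ?sin_acos ?ab1 ?sqrtr_sqr ?ltr0_norm ?opprK.
Qed.

(** The scale [t] moves into the coefficients, which then need no normalisation. Nonemptiness of [A]
    matters at [t = 0]: the empty sum represents 0, but [conv A] must have a point to dilate. *)
Lemma dilate_convP (R : realType) (E : lmodType R[i]) (A : set E) (t : R) (x : E) :
  A !=set0 -> 0 <= t ->
  dilate t (Defs.conv A) x <->
  exists (n : nat) (c : 'I_n -> R) (a : 'I_n -> E),
    [/\ forall i, 0 <= c i, \sum_i c i = t, forall i, A (a i)
      & x = \sum_i (c i)%:C *: a i].
Proof.
move=> [a0 Aa0] t_ge0; split.
  move=> [_ [n [c [a [c_ge0 c1 Aa ->]]]] <-].
  exists n, (fun i => t * c i), a; split=> // [i||].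
  - by rewrite mulr_ge0.
  - by rewrite -mulr_sumr c1 mulr1.
  - by rewrite scaler_sumr; apply: eq_bigr => i _; rewrite scalerA -rmorphM.
move=> [n [c [a [c_ge0 ct Aa ->]]]].
(* For [t = 0] all [c i] vanish and cannot be normalised, so [a0] serves as the convex
   combination. *)
have [t0|t_neq0] := eqVneq t 0.
  exists a0; last first.
    rewrite t0 scale0r big1 // => i _.
    by rewrite (psumr_eq0P (fun j _ => c_ge0 j) (etrans ct t0)) // scale0r.
  exists 1%N, (fun=> 1), (fun=> a0); split=> //; first by rewrite big_ord1.
  by rewrite big_ord1 scale1r.
exists (\sum_i (c i / t)%:C *: a i); last first.
  rewrite scaler_sumr; apply: eq_bigr => i _.
  by rewrite scalerA -rmorphM mulrC divfK.
exists n, (fun i => c i / t), a; split=> // [i|]; first by rewrite divr_ge0.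
by rewrite -mulr_suml ct divff.
Qed.

(** * Inner products and positive semidefinite forms *)

Section PositiveForms.
Local Open Scope sesquilinear_scope.
Context {R : realType} {d : nat}.
Implicit Types (u v w : 'cV[R[i]]_d) (M : 'M[R[i]]_d)
  (V : set 'cV[R[i]]_d).

Definition inner u v : R[i] := (u ^t* *m v) 0 0.

Definition form M v : R[i] := (v ^t* *m M *m v) 0 0.

Lemma trmxC_mul m n p (A : 'M[R[i]]_(m, n)) (B : 'M[R[i]]_(n, p)) :
  (A *m B) ^t* = B ^t* *m A ^t*.
Proof. by rewrite trmx_mul map_mxM. Qed.

Lemma trmxC_scale (a : R) M : (a%:C *: M) ^t* = a%:C *: M ^t*.
Proof.
apply/matrixP => i j; rewrite !mxE rmorphM /=; congr (_ * _).
by apply/eqP; rewrite eq_complex /= oppr0 !eqxx.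
Qed.

Lemma ketbra_herm v : (ketbra v) ^t* = ketbra v.
Proof. by rewrite trmxC_mul trmxCK. Qed.

Lemma mxtrace_ketbra v : \tr (ketbra v) = inner v v.
Proof. by rewrite mxtrace_mulC trace_mx11. Qed.

Lemma inner_conj u v : inner v u = Num.conj (inner u v).
Proof.
have -> : inner v u = ((u ^t* *m v) ^t*) 0 0 by rewrite trmxC_mul trmxCK.
by rewrite mxE mxE.
Qed.

Lemma mul_ketbra n v (A : 'M[R[i]]_(n, d)) w : A *m ketbra v *m w = inner v w *: (A *m v).
Proof.
by rewrite /ketbra !mulmxA -(mulmxA _ (v^t*)) [v^t* *m w]mx11_scalar mul_mx_scalar.
Qed.

Lemma form_ketbra v w : form (ketbra v) w = `|inner v w| ^+ 2.
Proof.
by rewrite /form mul_ketbra mxE -/(inner w v) (inner_conj v w) normCK.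
Qed.

Lemma formD M N v : form (M + N) v = form M v + form N v.
Proof. by rewrite /form mulmxDr mulmxDl mxE. Qed.

Lemma formZ a M v : form (a *: M) v = a * form M v.
Proof. by rewrite /form -scalemxAr -scalemxAl mxE. Qed.

Lemma form_sum n (F : 'I_n -> 'M[R[i]]_d) v : form (\sum_i F i) v = \sum_i form (F i) v.
Proof. by rewrite /form mulmx_sumr mulmx_suml summxE. Qed.

Lemma inner_sum u n (F : 'I_n -> 'cV[R[i]]_d) : inner u (\sum_i F i) = \sum_i inner u (F i).
Proof. by rewrite /inner mulmx_sumr summxE. Qed.

Lemma innerZ u a v : inner u (a *: v) = a * inner u v.
Proof. by rewrite /inner -scalemxAr mxE. Qed.

Lemma innerDr u v w : inner u (v + w) = inner u v + inner u w.
Proof. by rewrite /inner mulmxDr mxE. Qed.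

Lemma innerDl u v w : inner (u + v) w = inner u w + inner v w.
Proof. by rewrite inner_conj innerDr rmorphD /= -!inner_conj. Qed.

Lemma innerZl a v w : inner (a *: v) w = Num.conj a * inner v w.
Proof. by rewrite inner_conj innerZ rmorphM /= -inner_conj. Qed.

Lemma density_ketbra v : unit_vector v -> density_matrices (ketbra v).
Proof.
move=> v1; split.
- by apply/is_hermitianmxP; rewrite expr0 scale1r ketbra_herm.
- by move=> w; rewrite -/(form _ w) form_ketbra exprn_ge0.
- by rewrite mxtrace_ketbra.
Qed.

Lemma inner_delta M i j : inner (delta_mx i 0) (M *m delta_mx j 0) = M i j.
Proof. by rewrite /inner trmx_delta map_delta_mx -rowE -colE !mxE. Qed.

Lemma form_inner M v : form M v = inner v (M *m v).
Proof. by rewrite /form /inner mulmxA. Qed.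

(** The diagonal entries are nonnegative with sum zero, so they vanish; a nonzero entry off the
    diagonal would then make the form negative somewhere. *)
Lemma psd_trace0 M : M ^t* = M -> (forall v, 0 <= form M v) -> \tr M = 0 -> M = 0.
Proof.
move=> Mh M_ge0 trM; have Mdiag i : M i i = 0.
  apply: (psumr_eq0P _ trM) => // j _.
  by rewrite -inner_delta -form_inner.
apply/matrixP => i j; rewrite [RHS]mxE; pose z := M i j.
have Mji : M j i = Num.conj z by rewrite -[in LHS]Mh mxE mxE.
(* For this vector the form evaluates to [- 2 |M i j| ^ 2]. *)
have := M_ge0 (delta_mx i 0 + (- Num.conj z) *: delta_mx j 0).
rewrite form_inner mulmxDr -scalemxAr !(innerDl, innerDr, innerZ, innerZl).
rewrite !inner_delta !Mdiag Mji -/z rmorphN /= conjCK !mulr0 add0r addr0.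
rewrite !mulNr mulrC -opprD -normCK -mulr2n.
rewrite oppr_ge0 pmulrn_lle0 // => z0.
by apply/eqP; rewrite -/z -normr_eq0 -sqrf_eq0 eq_le z0 exprn_ge0.
Qed.

(** A vector in the kernel of [M] makes the form vanish, hence is orthogonal to [v]; the range of a
    Hermitian matrix is the orthogonal complement of its kernel. *)
Lemma range_of_dominating v M : M ^t* = M ->
  (forall w, `|inner v w| ^+ 2 <= form M w) -> exists x, v = M *m x.
Proof.
move=> Mh Mge.
(* [submx] compares row spaces, hence the adjoint of [v]. The columns of the cokernel [K] span the
   kernel of [M]. *)
have /submxP[z vz] : (v ^t* <= M)%MS.
  rewrite submxE; move: (cokermx M) (mulmx_coker M) => K MK.
  apply/eqP/matrixP => i j; rewrite !ord1 [RHS]mxE.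
  have := Mge (K *m delta_mx j 0).
  rewrite form_inner mulmxA MK mul0mx /inner mulmx0 mulmxA -colE !mxE => vj.
  by apply/eqP; rewrite -normr_eq0 -sqrf_eq0 eq_le vj exprn_ge0.
by exists (z ^t*); rewrite -[v]trmxCK vz trmxC_mul Mh.
Qed.

(** * Nonnegative combinations of pure states *)

Definition mixture n (p : 'I_n -> R) (v : 'I_n -> 'cV[R[i]]_d) : 'M[R[i]]_d :=
  \sum_i (p i)%:C *: ketbra (v i).

Lemma mixture_herm n (p : 'I_n -> R) (v : 'I_n -> 'cV[R[i]]_d) :
  (mixture n p v) ^t* = mixture n p v.
Proof.
rewrite /mixture !raddf_sum /=; apply: eq_bigr => i _.
by rewrite trmxC_scale ketbra_herm.
Qed.

Lemma form_mixture n (p : 'I_n -> R) (v : 'I_n -> 'cV[R[i]]_d) w :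
  form (mixture n p v) w = \sum_i (p i)%:C * `|inner (v i) w| ^+ 2.
Proof. by rewrite form_sum; apply: eq_bigr => i _; rewrite formZ form_ketbra. Qed.

Lemma mxtrace_mixture n (p : 'I_n -> R) (v : 'I_n -> 'cV[R[i]]_d) :
  (forall i, unit_vector (v i)) -> \tr (mixture n p v) = (\sum_i p i)%:C.
Proof.
move=> v1; rewrite raddf_sum rmorph_sum; apply: eq_bigr => i _ /=.
by rewrite linearZ /= mxtrace_ketbra /inner v1 mulr1.
Qed.

Lemma psd_trace_ge0 M : (forall v, 0 <= form M v) -> 0 <= \tr M.
Proof.
by move=> M_ge0; apply: sumr_ge0 => i _; rewrite -inner_delta -form_inner.
Qed.

Lemma norm_inner_conj u v : `|inner u v| = `|inner v u|.
Proof. by rewrite inner_conj norm_conjC. Qed.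

(** * Passing between feasible values of the gauge and of the robustness *)

Lemma gauge_feasible_robustness V psi (t : R) :
  V !=set0 -> (forall v, V v -> unit_vector v) -> unit_vector psi ->
  0 <= t -> dilate t (Defs.conv V) psi ->
  0 <= t ^+ 2 - 1 /\ exists2 omega, density_matrices omega &
    cone (pure_states V) (ketbra psi + (t ^+ 2 - 1)%:C *: omega).
Proof.
move=> V0 V1 psi1 t_ge0 /(dilate_convP _ _ _ _ _ V0 t_ge0).
move=> [n [c [v [c_ge0 ct Vv psiE]]]].
(* The extra factor [t] is the one produced by Cauchy-Schwarz; it gives [M] the trace [t ^ 2]. *)
pose M := mixture n (fun i => t * c i) v; pose N := M - ketbra psi.
have tc : \sum_i t * c i = t ^+ 2 by rewrite -mulr_sumr ct expr2.
have Nh : N ^t* = N by rewrite /N raddfB /= rmorphB /= mixture_herm ketbra_herm.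
have N_ge0 w : 0 <= form N w.
  rewrite /N -scaleN1r formD formZ mulN1r subr_ge0 form_ketbra form_mixture.
  rewrite norm_inner_conj psiE inner_sum.
  under eq_bigr do rewrite innerZ.
  apply: le_trans (weighted_cauchy_schwarz _ _ _ _ _) _.
    by move=> i; rewrite lecR.
  rewrite -rmorph_sum /= ct mulr_sumr; apply: ler_sum => i _.
  by rewrite norm_inner_conj rmorphM mulrA.
have trN : \tr N = (t ^+ 2 - 1)%:C.
  rewrite raddfB /= mxtrace_mixture ?tc; last by move=> i; exact/V1.
  by rewrite mxtrace_ketbra /inner psi1 rmorphB.
have t2_ge1 : 0 <= t ^+ 2 - 1 by rewrite -lecR -trN psd_trace_ge0.
split=> //.
have coneM : cone (pure_states V) M.
  exists (t ^+ 2); first exact: sqr_ge0.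
  apply/dilate_convP; rewrite ?sqr_ge0 //.
    by case: V0 => v0 Vv0; exists (ketbra v0), v0.
  exists n, (fun i => t * c i), (fun i => ketbra (v i)); split=> // i.
    by rewrite mulr_ge0.
  by exists (v i).
have ME : M = ketbra psi + N by rewrite addrC subrK.
(* When the trace of [N] is zero, [N] cannot be normalised, but it vanishes, so any density matrix
   serves as [omega]. *)
have [t21|t2_neq1] := eqVneq (t ^+ 2 - 1) 0.
  exists (ketbra psi); first exact: density_ketbra.
  by rewrite t21 scale0r -(psd_trace0 N) // -?ME // trN t21.
exists ((t ^+ 2 - 1)^-1%:C *: N); last first.
  by rewrite scalerA -rmorphM divff // scale1r -ME.
split.
- by apply/is_hermitianmxP; rewrite expr0 scale1r trmxC_scale Nh.
- by move=> w; rewrite -/(form _ w) formZ mulr_ge0 // lecR invr_ge0.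
- by rewrite linearZ /= trN -rmorphM mulVf.
Qed.

Lemma robustness_feasible_gauge V psi (s : R) omega :
  V !=set0 -> (forall v, V v -> unit_vector v) ->
  (forall v (theta : R), V v -> V (phase theta *: v)) -> unit_vector psi ->
  0 <= s -> density_matrices omega ->
  cone (pure_states V) (ketbra psi + s%:C *: omega) ->
  exists t : R, [/\ 0 <= t, t ^+ 2 <= 1 + s & dilate t (Defs.conv V) psi].
Proof.
move=> V0 V1 Vphase psi1 s_ge0 [om_herm om_ge0 om_tr] [q q_ge0].
move/dilate_convP => [] //; first by case: V0 => v0 Vv0; exists (ketbra v0), v0.
move=> n [p [a [p_ge0 pq Va]]].
have [v vP] : {v : 'I_n -> 'cV[R[i]]_d & forall i, V (v i) /\ ketbra (v i) = a i}.
  apply: (choice (P := fun i w => V w /\ ketbra w = a i)) => i.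
  by have [w Vw wa] := Va i; exists w.
under eq_bigr do rewrite -(vP _).2.
rewrite -/(mixture n p v) => ME; set M := mixture n p v in ME.
(* The total weight of a mixture of unit vectors is its trace, so comparing traces determines
   [q]. *)
have trM : q = 1 + s.
  apply: (fmorph_inj (real_complex R)).
  rewrite /= -pq -(mxtrace_mixture _ _ v) => [|i]; last exact/V1/(vP i).1.
  rewrite -/M -ME raddfD /= linearZ /= om_tr mxtrace_ketbra /inner psi1.
  by rewrite mulr1 rmorphD.
have M_ge w : `|inner psi w| ^+ 2 <= form M w.
  rewrite -ME formD formZ form_ketbra lerDl mulr_ge0 ?lecR //; exact: om_ge0.
have [x psiE] := range_of_dominating _ _ (mixture_herm n p v) M_ge.
(* The modulus in [R[i]] is itself an element of [R[i]]; [r i] is its value in [R]. *)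
pose r i := complex.Re `|inner (v i) x|.
have rE i : `|inner (v i) x| = (r i)%:C by rewrite /r normc_def.
have r_ge0 i : 0 <= r i by rewrite -lecR -rE normr_ge0.
pose y := \sum_i p i * r i ^+ 2.
have yE : form M x = y%:C.
  rewrite form_mixture rmorph_sum; apply: eq_bigr => i _.
  by rewrite rE -rmorphXn -rmorphM.
have y_ge0 : 0 <= y by apply: sumr_ge0 => i _; rewrite mulr_ge0 ?exprn_ge0.
(* As [psi = M x], the number [y] is also the inner product of [psi] and [x]; domination at [x]
   reads [y ^ 2 <= y]. *)
have y_le1 : y <= 1.
  have := M_ge x; rewrite norm_inner_conj {1}psiE -form_inner yE.
  rewrite ger0_norm ?lecR // -rmorphXn lecR => y2.
  nra.
exists (\sum_i p i * r i); split.
- by apply: sumr_ge0 => i _; rewrite mulr_ge0.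
- have := weighted_cauchy_schwarz _ _ p r p_ge0.
  rewrite pq trM ger0_norm; last by apply: sumr_ge0 => i _; rewrite mulr_ge0.
  under [X in _ * X]eq_bigr do rewrite ger0_norm //.
  by move=> /le_trans; apply; rewrite -/y ler_piMr // addr_ge0.
apply/dilate_convP => //; first by apply: sumr_ge0 => i _; rewrite mulr_ge0.
(* The coefficients [p i * inner (v i) x] of [psi] are split into moduli and phases, the latter
   going to the vectors. *)
have [theta thetaE] := @choice _ _ _ (fun i => complex_polar R (inner (v i) x)).
exists n, (fun i => p i * r i), (fun i => phase (theta i) *: v i); split=> //.
- by move=> i; rewrite mulr_ge0.
- by move=> i; apply/Vphase/(vP i).1.
rewrite {1}psiE mulmx_suml; apply: eq_bigr => i _.
rewrite -scalemxAl -[ketbra _]mul1mx mul_ketbra mul1mx thetaE rE.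
by rewrite !scalerA rmorphM mulrA.
Qed.

End PositiveForms.

(** * Comparison of the two infima *)

Theorem theorem10 (R : realType) (d : nat) (d_ge1 : (1 <= d)%N)
  (V : set 'cV[R[i]]_d)
  (V_neq0 : V !=set0)
  (V_compact : compact V)
  (V_unit : forall v, V v -> unit_vector v)
  (V_phase : forall v (theta : R), V v -> V (phase theta *: v))
  (psi : 'cV[R[i]]_d) (psi_unit : unit_vector psi)
  (psi_dom : robustness_dom (pure_states V) (ketbra psi)) :
  robustness (pure_states V) (ketbra psi) = (atomic_gauge V psi ^+ 2 - 1)%E.
Proof.
pose T := [set t : R | 0 <= t /\ dilate t (Defs.conv V) psi].
have R_lb t : T t -> (robustness (pure_states V) (ketbra psi) <= (t ^+ 2 - 1)%:E)%E.
  move=> [t_ge0 tV]; apply: ereal_inf_lbound; exists (t ^+ 2 - 1) => //.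
  exact: gauge_feasible_robustness.
have [_ /fineK rE] := psi_dom.
pose r := fine (robustness (pure_states V) (ketbra psi)).
have r_ge0 : 0 <= r.
  rewrite -lee_fin rE; apply: le_ereal_inf_tmp => _ [s [s_ge0 _] <-].
  by rewrite lee_fin.
(* Without a feasible [s] the robustness would be the infimum of the empty set, [+oo]. The feasible
   [s0] then yields a feasible [t0], so the gauge is finite and the claim reduces to real
   numbers. *)
have [s0 [s0_ge0 [om0 om0D s0V]]] : exists s : R, 0 <= s /\
    exists2 omega, density_matrices omega &
      cone (pure_states V) (ketbra psi + s%:C *: omega).
  apply: contrapT => noS; have := psi_dom.2; rewrite /robustness.
  rewrite (_ : [set s%:E | s in _] = set0) ?ereal_inf0 //.
  by rewrite -subset0 => _ [s sS <-]; apply: noS; exists s.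
have [t0 [t0_ge0 _ t0V]] :=
  robustness_feasible_gauge _ _ _ _ V_neq0 V_unit V_phase psi_unit s0_ge0 om0D s0V.
have gE : (fine (atomic_gauge V psi))%:E = atomic_gauge V psi.
  apply: fineK; rewrite fin_numElt; apply/andP; split.
    apply: (@lt_le_trans _ _ 0%E); first exact: ltNy0.
    by apply: le_ereal_inf_tmp => _ [t [t_ge0 _] <-]; rewrite lee_fin.
  by apply: le_lt_trans (ltry t0); apply: ereal_inf_lbound; exists t0.
set g := fine _ in gE.
have g_ge0 : 0 <= g.
  by rewrite -lee_fin gE; apply: le_ereal_inf_tmp => _ [t [t_ge0 _] <-]; rewrite lee_fin.
rewrite -gE -rE -EFin_expe -EFinB -/r; congr EFin; apply/le_anti/andP; split.
  (* The gauge is an infimum of [t], not of [t ^ 2], so the bound is taken in the form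
     [Num.sqrt (r + 1) <= t] for every feasible [t]. *)
  rewrite lerBrDr -[leLHS]sqr_sqrtr ?addr_ge0 // lerXn2r ?nnegrE ?sqrtr_ge0 //.
  rewrite -lee_fin gE; apply: le_ereal_inf_tmp => _ [t Tt <-]; rewrite lee_fin.
  have := R_lb t Tt; rewrite -rE lee_fin lerBrDr -/r => rt.
  by rewrite -(ger0_norm Tt.1) -sqrtr_sqr ler_wsqrtr.
(* Each feasible [s] provides a feasible [t] with [g ^ 2 <= t ^ 2 <= 1 + s]. *)
rewrite -lee_fin rE; apply: le_ereal_inf_tmp => _ [s [s_ge0 [om omD sV]] <-].
have [t [t_ge0 ts tV]] :=
  robustness_feasible_gauge _ _ _ _ V_neq0 V_unit V_phase psi_unit s_ge0 omD sV.
rewrite lee_fin lerBlDl; apply: le_trans ts; rewrite lerXn2r ?nnegrE //.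
by rewrite -lee_fin gE; apply: ereal_inf_lbound; exists t.
Qed.
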